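(* Let $\mathfrak{s}=(s_1,\ldots,s_r)\in\mathbb{N}^r$, and let $H_n(t)\in A[t]$ ($n=0,1,2,\ldots$) be the Anderson–Thakur polynomials. Write $H_{s_j-1}=\sum_{m}u_{j,m}t^{m}$ with $u_{j,m}\in A$, for $j=1,\ldots,r$. Then for all $(m_1,\ldots,m_r)$ with $0\le m_j\le\deg_tH_{s_j-1}$ for every $j$, the point $(u_{1,m_1},\ldots,u_{r,m_r})\in A^r$ belongs to $\mathbb{D}_{\mathfrak{s}}$, and \[\zeta_A(s_1,\ldots,s_r)=\frac{1}{\Gamma_{s_1}\cdots\Gamma_{s_r}}\sum_{(m_1,\ldots,m_r)}\theta^{m_1+\cdots+m_r}\,\mathrm{Li}_{\mathfrak{s}}(u_{1,m_1},\ldots,u_{r,m_r}),\] where the sum is over all $(m_1,\ldots,m_r)$ with $0\le m_j\le\deg_tH_{s_j-1}$ for $j=1,\ldots,r$.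
   Context: Let $q$ be a power of a prime $p$, $\theta,t$ independent variables, $A=\mathbb{F}_q[\theta]$, $A_+$ the set of monic polynomials in $A$, $k=\mathbb{F}_q(\theta)$, $k_\infty=\mathbb{F}_q(\!(1/\theta)\!)$, $\overline{k_\infty}$ a fixed algebraic closure of $k_\infty$, and $\mathbb{C}_\infty$ the completion of $\overline{k_\infty}$. $\mathbb{N}$ is the set of positive integers. For $s\in\mathbb{N}$ and an integer $d\ge0$ put $S_d(s)=\sum_{a\in A_+,\ \deg a=d}a^{-s}$. The multizeta value at $(s_1,\ldots,s_r)\in\mathbb{N}^r$ is $\zeta_A(s_1,\ldots,s_r)=\sum_{d_1>\cdots>d_r\ge0}S_{d_1}(s_1)\cdots S_{d_r}(s_r)\in k_\infty$. Put $\mathcal{L}_0:=1$, $\mathcal{L}_i:=\prod_{j=1}^i(\theta-\theta^{q^j})$ for $i\in\mathbb{N}$. The Carlitz multiple polylogarithm is \[\mathrm{Li}_{\mathfrak{s}}(z_1,\ldots,z_r):=\sum_{i_1>\cdots>i_r\ge0}\frac{z_1^{q^{i_1}}\cdots z_r^{q^{i_r}}}{\mathcal{L}_{i_1}^{s_1}\cdots\mathcal{L}_{i_r}^{s_r}},\] and $\mathbb{D}_{\mathfrak{s}}$ is the set of points of $\mathbb{C}_\infty^r$ at which it converges. Carlitz factorials: $D_0:=1$, $D_n:=\prod_{i=0}^{n-1}(\theta^{q^n}-\theta^{q^i})$ for $n\in\mathbb{N}$; for an integer $n\ge0$ with base $q$ expansion $n=\sum_i n_iq^i$ ($0\le n_i\le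 q-1$), $\Gamma_{n+1}:=\prod_iD_i^{n_i}$. For $f=\sum a_it^i\in\mathbb{C}_\infty(\!(t)\!)$ and an integer $n$, $f^{(n)}:=\sum a_i^{q^n}t^i$. Fix a $(q-1)$-th root $\tilde{\theta}$ of $-\theta$ in $\overline{k_\infty}$; $\Omega(t):=\tilde{\theta}^{-q}\prod_{i=1}^\infty(1-t/\theta^{q^i})$ and $\tilde{\pi}:=1/\Omega(\theta)$. Anderson–Thakur polynomials: by a theorem of Anderson and Thakur there is a sequence of polynomials $H_n(t)\in A[t]$ ($n=0,1,2,\ldots$) such that $(H_{s-1}\Omega^s)^{(d)}(\theta)=\Gamma_sS_d(s)/\tilde{\pi}^s$ for all integers $d\ge0$ and all $s\in\mathbb{N}$, and such that, regarding $H_n$ as a polynomial in $\theta$ over $\mathbb{F}_q[t]$, $\deg_\theta H_n\le\frac{nq}{q-1}$. The $H_n$ in the claim are these polynomials. *)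

(* Defs.v *)
From HB Require Import structures.
From mathcomp Require Import all_boot all_order all_algebra.
From mathcomp Require Import finmap.
From mathcomp Require Import all_classical all_reals all_analysis.
From mathcomp.analysis.showcase Require Import summability.

Set Implicit Arguments.
Unset Strict Implicit.
Unset Printing Implicit Defensive.

Import Order.TTheory GRing.Theory Num.Theory.
Import numFieldNormedType.Exports.
Local Open Scope classical_set_scope.
Local Open Scope ring_scope.

(* normedZmodType requires `|x *+ n| = `|x| *+ n, which fails in positive
   characteristic, hence this separate structure. *)
Record valuedField (R : realType) := ValuedField {
  vf_sort :> fieldType;
  vabs : vf_sort -> R;
  vabs_ge0 : forall x, 0 <= vabs x;
  vabs_eq0 : forall x, (vabs x == 0) = (x == 0);
  vabsM : forall x y, vabs (x * y) = vabs x * vabs y;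
  vabsD : forall x y, vabs (x + y) <= Num.max (vabs x) (vabs y)
}.

Section Valued.
Variables (R : realType) (K : valuedField R).

Definition vcvg (T : Type) (u : T -> K) (G : set_system T) (l : K) : Prop :=
  vabs (u x - l) @[x --> G] --> (0 : R).

(* junk value 0 when the limit does not exist *)
Definition vlim (T : Type) (u : T -> K) (G : set_system T) : K :=
  xget 0 [set l | vcvg u G l].

(* Series over a countable index set that has no preferred order are taken in
   the unordered sense: the limit of the finite partial sums along the
   inclusion-directed finite subsets of the index set. *)
Definition vsummable (I : choiceType) (f : I -> K) : Prop :=
  exists l, vcvg (partial_sum f) totally l.

Definition vsum (I : choiceType) (f : I -> K) : K :=
  vlim (partial_sum f) totally.

Definition vcauchy (u : nat -> K) : Prop :=
  forall e : R, 0 < e -> exists N : nat,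
    forall m n : nat, (N <= m)%N -> (N <= n)%N -> vabs (u m - u n) < e.

Variables (F : finFieldType) (emb : {rmorphism {poly F} -> K}).

(* F((1/theta)), where theta = emb 'X: the sums in K of the series
   theta^N * sum_(i >= 0) c_i theta^(-i), with c_i in F. *)
Definition k_inf : set K :=
  [set x | exists (N : nat) (c : nat -> F),
     vcvg (fun n => emb 'X ^+ N * \sum_(i < n) emb (c i)%:P / emb 'X ^+ i) \oo x].

Definition k_inf_bar : set K :=
  [set x | exists p : {poly K}, [/\ p != 0, forall i, k_inf p`_i & root p x]].

End Valued.

(* The completion of an algebraic closure of F((1/theta)), characterized inside
   itself: it is complete, and the elements algebraic over F((1/theta)) form an
   algebraically closed field that is dense.  The polynomial ring A = F[theta]
   is {poly F}, with theta = 'X, and the absolute value is normalized by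
   |theta| = #|F|. *)
Record Cinfty (R : realType) (F : finFieldType) := CInfty {
  Cinf_vf :> valuedField R;
  embA : {rmorphism {poly F} -> Cinf_vf};
  vabs_embA : forall a : {poly F}, a != 0 ->
    vabs (embA a) = #|F|%:R ^+ (size a).-1;
  Cinf_complete : forall u : nat -> Cinf_vf, vcauchy u ->
    exists l, vcvg u \oo l;
  k_inf_bar_closed : forall p : {poly Cinf_vf},
    (forall i, k_inf_bar embA p`_i) -> (1 < size p)%N ->
    exists2 x, k_inf_bar embA x & root p x;
  k_inf_bar_dense : forall (x : Cinf_vf) (e : R), 0 < e ->
    exists2 y, k_inf_bar embA y & vabs (x - y) < e
}.

Section CarlitzPolynomials.
Variable F : finFieldType.

Definition carlitz_L (i : nat) : {poly F} :=
  \prod_(1 <= j < i.+1) ('X - 'X^(#|F| ^ j)).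

Definition carlitz_D (n : nat) : {poly F} :=
  \prod_(i < n) ('X^(#|F| ^ n) - 'X^(#|F| ^ i)).

(* Gamma_s for s >= 1: the exponents are the base #|F| digits of s - 1, and the
   digits of index >= s vanish. *)
Definition carlitz_Gamma (s : nat) : {poly F} :=
  \prod_(i < s) carlitz_D i ^+ ((s.-1 %/ #|F| ^ i) %% #|F|).

End CarlitzPolynomials.

Notation decr_tuple r := {i : r.-tuple nat | sorted gtn i}.

Section Statement.
Variables (R : realType) (F : finFieldType) (C : Cinfty R F).

Definition power_sum (d s : nat) : C :=
  \sum_(a : {poly_d.+1 F} | (polyn a \is monic) && (size a == d.+1))
     (embA C a)^-1 ^+ s.

Definition multizeta (r : nat) (s : 'I_r -> nat) : C :=
  vsum (fun d : decr_tuple r => \prod_(j < r) power_sum (tnth (val d) j) (s j)).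

Definition Li_term (r : nat) (s : 'I_r -> nat) (z : 'I_r -> C)
    (i : decr_tuple r) : C :=
  \prod_(j < r) (z j ^+ (#|F| ^ tnth (val i) j)
                 / embA C (carlitz_L F (tnth (val i) j)) ^+ s j).

Definition Li (r : nat) (s : 'I_r -> nat) (z : 'I_r -> C) : C :=
  vsum (Li_term s z).

Definition Li_domain (r : nat) (s : 'I_r -> nat) : set ('I_r -> C) :=
  [set z | vsummable (Li_term s z)].

(* A power series in t over C is its sequence of coefficients. *)
Definition ps_mul (f g : nat -> C) : nat -> C :=
  fun n => \sum_(i < n.+1) f i * g (n - i)%N.

Definition ps_exp (f : nat -> C) (n : nat) : nat -> C :=
  iter n (ps_mul f) (fun m => (m == 0%N)%:R).

Definition ps_twist (d : nat) (f : nat -> C) : nat -> C :=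
  fun m => f m ^+ (#|F| ^ d).

Definition ps_eval (f : nat -> C) (x : C) : C :=
  vsum (fun m : nat => f m * x ^+ m).

Definition ps_of_At (h : {poly {poly F}}) : nat -> C := fun m => embA C h`_m.

(* theta' is the chosen (q-1)-th root of - theta; the infinite product is the
   coefficientwise limit of its partial products. *)
Definition Omega (theta' : C) : nat -> C :=
  fun m => vlim (fun N : nat =>
    ((theta' ^- #|F|)%:P *
     \prod_(1 <= i < N.+1) (1 - (embA C 'X ^- (#|F| ^ i)) *: 'X))`_m) \oo.

Definition pi_tilde (theta' : C) : C := (ps_eval (Omega theta') (embA C 'X))^-1.

(* H n is an element of A[t] = {poly {poly F}}, the outer variable being t, so
   that (sizeY (H n)).-1 is its degree in theta. *)
Definition anderson_thakur (theta' : C) (H : nat -> {poly {poly F}}) : Prop :=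
  (forall d s : nat, (0 < s)%N ->
     ps_eval (ps_twist d (ps_mul (ps_of_At (H s.-1)) (ps_exp (Omega theta') s)))
             (embA C 'X)
     = embA C (carlitz_Gamma F s) * power_sum d s / pi_tilde theta' ^+ s) /\
  (forall n : nat, ((sizeY (H n)).-1 * (#|F| - 1) <= n * #|F|)%N).

End Statement.

(* Main.v *)
(* Put W_d := Omega^(d)(theta).  Twisting the product defining Omega shifts its
   factors and gives W_d = (theta - theta^(q^(d+1))) W_(d+1), hence
   W_0 = L_d W_d with W_0 != 0, and twisting and evaluation at theta are
   multiplicative.  So the Anderson-Thakur identity becomes
     Gamma_s S_d(s) = sum_m theta^m u_m^(q^d) / L_d^s;
   multiply over j and sum over d_1 > ... > d_r.  The bound on deg_theta H_(s-1)
   gives |u_m^(q^d) / L_d^s|^(q-1) <= q^(qs - q^(d+1)), so each factor tends to 0,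
   and in a complete ultrametric field this suffices for unordered summability. *)
Require Import Defs.
From HB Require Import structures.
From mathcomp Require Import all_boot all_order all_algebra.
From mathcomp Require Import pgroup abelian finfield finmap.
From mathcomp Require Import all_classical all_reals all_analysis.
From mathcomp.analysis.showcase Require Import summability.
From mathcomp Require Import ring.

Set Implicit Arguments.
Unset Strict Implicit.
Unset Printing Implicit Defensive.

Import Order.TTheory GRing.Theory Num.Theory.
Import numFieldNormedType.Exports.
Local Open Scope classical_set_scope.
Local Open Scope ring_scope.

#[local] Existing Instance totally_filter.

(** * Ultrametric absolute values and limits along a filter *)

Section ValuedFieldTheory.
Variables (R : realType) (K : valuedField R).
Implicit Types (x y l : K) (e : R).

Lemma vabs0 : vabs (0 : K) = 0.
Proof. by apply/eqP; rewrite vabs_eq0. Qed.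

Lemma vabs_gt0 x : (0 < vabs x) = (x != 0).
Proof. by rewrite lt_neqAle vabs_ge0 andbT eq_sym vabs_eq0. Qed.

Lemma vabs1 : vabs (1 : K) = 1.
Proof.
have n0 : vabs (1 : K) != 0 by rewrite vabs_eq0 oner_eq0.
by apply: (mulfI n0); rewrite -vabsM !mulr1.
Qed.

Lemma vabsX x n : vabs (x ^+ n) = vabs x ^+ n.
Proof. by elim: n => [|n IH]; rewrite ?expr0 ?vabs1 // !exprS vabsM IH. Qed.

Lemma vabsN x : vabs (- x) = vabs x.
Proof.
have : vabs (- x) ^+ 2 == vabs x ^+ 2 by rewrite -!vabsX sqrrN.
by rewrite eqrXn2 ?vabs_ge0 // => /eqP.
Qed.

Lemma vabsBC x y : vabs (x - y) = vabs (y - x).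
Proof. by rewrite -vabsN opprB. Qed.

Lemma vabsV x : vabs x^-1 = (vabs x)^-1.
Proof.
have [->|x0] := eqVneq x 0; first by rewrite invr0 vabs0 invr0.
have n0 : vabs x != 0 by rewrite vabs_eq0.
by apply: (mulfI n0); rewrite -vabsM !divff // vabs1.
Qed.

Lemma vabs_prod (I : Type) (s : seq I) (P : pred I) (f : I -> K) :
  vabs (\prod_(i <- s | P i) f i) = \prod_(i <- s | P i) vabs (f i).
Proof. by apply: big_morph; [exact: vabsM | exact: vabs1]. Qed.

Lemma vabsD_le x y e : vabs x <= e -> vabs y <= e -> vabs (x + y) <= e.
Proof. by move=> xe ye; rewrite (le_trans (vabsD _ _)) // ge_max xe. Qed.

Lemma vabsD_lt x y e : vabs x < e -> vabs y < e -> vabs (x + y) < e.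
Proof. by move=> xe ye; rewrite (le_lt_trans (vabsD _ _)) // gt_max xe. Qed.

Lemma vabs_sum_le (I : eqType) (s : seq I) (P : pred I) (f : I -> K) e :
  0 <= e -> (forall i, i \in s -> P i -> vabs (f i) <= e) ->
  vabs (\sum_(i <- s | P i) f i) <= e.
Proof.
move=> e0 fe; rewrite big_seq_cond; elim/big_ind: _ => [|x y|i].
- by rewrite vabs0.
- exact: vabsD_le.
- by case/andP; exact: fe.
Qed.

Lemma vcvgP (T : Type) (G : set_system T) {FG : Filter G} (u : T -> K) l :
  vcvg u G l <-> forall e, 0 < e -> \forall x \near G, vabs (u x - l) < e.
Proof.
rewrite /vcvg; split=> [/cvgr0Pnorm_lt ul e e0|ul].
  by near do rewrite -[vabs _]ger0_norm ?vabs_ge0 //; exact: ul.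
apply/cvgr0Pnorm_lt => e e0.
by near do rewrite ger0_norm ?vabs_ge0 //; exact: ul.
Unshelve. all: by end_near. Qed.

Lemma vcvg_unique (T : Type) (G : set_system T) {FG : ProperFilter G}
  (u : T -> K) l l' : vcvg u G l -> vcvg u G l' -> l = l'.
Proof.
move=> /vcvgP ul /vcvgP ul'; apply/eqP; rewrite -subr_eq0 -vabs_eq0.
rewrite eq_le vabs_ge0 andbT; apply/ler_addgt0Pr => e e0; rewrite add0r.
have [x [xl xl']] := filter_ex (filterI (ul e e0) (ul' e e0)).
by rewrite -(subrKA (u x)) vabsD_le ?ltW // vabsBC.
Qed.

Lemma vlimE (T : Type) (G : set_system T) {FG : ProperFilter G}
  (u : T -> K) l : vcvg u G l -> vlim u G = l.
Proof.
move=> ul; apply: xget_unique => // l' ul'; exact: (vcvg_unique ul' ul).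
Qed.

Lemma eq_vcvg (T : Type) (G : set_system T) (u v : T -> K) l :
  u =1 v -> vcvg u G l -> vcvg v G l.
Proof. by move=> /funext ->. Qed.

Lemma vcvgD (T : Type) (G : set_system T) {FG : Filter G} (u v : T -> K) l l' :
  vcvg u G l -> vcvg v G l' -> vcvg (fun z => u z + v z) G (l + l').
Proof.
move=> /vcvgP ul /vcvgP vl'; apply/vcvgP => e e0.
near=> x; rewrite opprD addrACA vabsD_lt //.
  by near: x; exact: ul.
by near: x; exact: vl'.
Unshelve. all: by end_near. Qed.

Lemma vcvg_sum (T : Type) (G : set_system T) {FG : Filter G} (I : Type)
  (s : seq I) (u : I -> T -> K) (l : I -> K) : (forall i, vcvg (u i) G (l i)) ->
  vcvg (fun z => \sum_(i <- s) u i z) G (\sum_(i <- s) l i).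
Proof.
move=> ul; elim: s => [|i s IH].
  by apply/vcvgP => e e0; near=> x; rewrite !big_nil subr0 vabs0.
rewrite big_cons; apply: eq_vcvg (vcvgD (ul i) IH) => x.
by rewrite big_cons.
Unshelve. all: by end_near. Qed.

Lemma vcvgZ (T : Type) (G : set_system T) {FG : Filter G} (u : T -> K) a l :
  vcvg u G l -> vcvg (fun z => a * u z) G (a * l).
Proof.
move=> /vcvgP ul; apply/vcvgP => e e0.
(* Adding 1 keeps the divisor positive when [a = 0]. *)
have a0 : 0 < vabs a + 1 by rewrite ltr_wpDl ?vabs_ge0.
near=> x; rewrite -mulrBr vabsM.
apply: (@le_lt_trans _ _ ((vabs a + 1) * vabs (u x - l))).
  by rewrite ler_wpM2r ?vabs_ge0 // lerDl.
rewrite mulrC -ltr_pdivlMr //; near: x; apply: ul.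
by rewrite divr_gt0.
Unshelve. all: by end_near. Qed.

End ValuedFieldTheory.

(** * Unordered summation over countable index sets *)

Section Summation.
Variables (R : realType) (K : valuedField R).
Implicit Types (e : R).

Lemma vcvg_le (T : Type) (G : set_system T) {FG : ProperFilter G} (u : T -> K)
  l a e : vcvg u G l -> (\forall x \near G, vabs (u x - a) <= e) ->
  vabs (l - a) <= e.
Proof.
move=> /vcvgP ul ua; have e0 : 0 <= e.
  by have [x] := filter_ex ua; apply: le_trans; exact: vabs_ge0.
apply/ler_addgt0Pr => d d0; have [x [xl xa]] := filter_ex (filterI (ul d d0) ua).
rewrite -(subrKA (u x)) vabsD_le ?(vabsBC l) //.
  by rewrite (le_trans (ltW xl)) // lerDr.
by rewrite (le_trans xa) // lerDl ltW.
Qed.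

Lemma vcvg_nat (u : nat -> K) l : vcvg u \oo l <->
  forall e, 0 < e -> exists N, forall n, (N <= n)%N -> vabs (u n - l) < e.
Proof.
rewrite vcvgP; split=> ul e e0; first by have [N _ NP] := ul e e0; exists N.
by have [N NP] := ul e e0; exists N.
Qed.

Lemma vcvg_shift (u : nat -> K) l : vcvg u \oo l ->
  vcvg (fun n => u n.+1) \oo l.
Proof.
rewrite !vcvg_nat => ul e /ul[N NP]; exists N => n Nn.
by apply: NP; rewrite (leq_trans Nn).
Qed.

Lemma partial_sumE (I : choiceType) (f : I -> K) (A : {fset I}) :
  partial_sum f A = \sum_(i <- A) f i.
Proof. by rewrite big_seq_fsetE. Qed.

(** The difference is the sum over [B] minus [A], and an ultrametric sum is at most its largest
    term. *)
Lemma vabs_partial_sumB (I : choiceType) (f : I -> K) (A B : {fset I}) e :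
  0 <= e -> (A `<=` B)%fset -> (forall i, i \notin A -> vabs (f i) <= e) ->
  vabs (partial_sum f B - partial_sum f A) <= e.
Proof.
move=> e0 /fsubsetP AB fe; rewrite !partial_sumE (big_fsetID _ (mem A) B) /=.
set D := (X in \sum_(i <- enum_fset X) f i + _); have -> : D = A.
  by apply/fsetP => i; rewrite !inE andbC; case: (boolP (i \in A)) => // /AB ->.
rewrite addrAC subrr add0r.
by apply: vabs_sum_le => // i; rewrite !inE => /andP[_ iA] _; exact: fe.
Qed.

(** One finite set per [e] suffices, because enlarging it moves the partial sum by at most [e]. *)
Lemma vcvg_totally (I : choiceType) (f : I -> K) l :
  (forall e, 0 < e -> exists A : {fset I},
     (forall i, i \notin A -> vabs (f i) <= e) /\
     vabs (partial_sum f A - l) <= e) ->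
  vcvg (partial_sum f) totally l.
Proof.
move=> H; apply/vcvgP => e e0; have e20 : 0 < e / 2 by rewrite divr_gt0.
have [A [fA lA]] := H _ e20; exists A => // B /= AB.
apply: (@le_lt_trans _ _ (e / 2)); last by rewrite gtr_pMr // invf_lt1 ?ltr1n.
by rewrite -(subrKA (partial_sum f A)) vabsD_le // vabs_partial_sumB // ltW.
Qed.

(** Links ordered series to unordered sums: initial segments serve as the finite sets. *)
Lemma vcvg_partial_sum_nat (f : nat -> K) l : vcvg f \oo 0 ->
  vcvg (fun n => \sum_(i < n) f i) \oo l -> vcvg (partial_sum f) totally l.
Proof.
move=> /vcvg_nat f0 /vcvg_nat fl; apply: vcvg_totally => e e0.
have [N NP] := f0 e e0; have [M MP] := fl e e0; set n := maxn N M.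
exists [fset i in iota 0 n]%fset; split=> [i|].
  rewrite inE mem_iota add0n /= -leqNgt geq_max => /andP[Ni _].
  by rewrite -[f i]subr0 ltW ?NP.
rewrite partial_sumE big_imfset //= undup_id ?iota_uniq //.
by rewrite -[n in iota 0 n]subn0 big_mkord ltW ?MP ?leq_maxr.
Qed.

(** Convergence to 0 along the cofinite filter of the index set. *)
Definition null_family (I : choiceType) (f : I -> K) : Prop :=
  forall e, 0 < e -> exists A : {fset I}, forall i, i \notin A -> vabs (f i) < e.

(** If some coordinate of [d] is large, its factor is tiny while the other factors stay bounded;
    only finitely many tuples have all coordinates small. *)
Lemma vcvg_null_prod (r : nat) (b : 'I_r -> nat -> K) :
  (forall j, vcvg (b j) \oo 0) ->
  null_family (fun d : decr_tuple r => \prod_(j < r) b j (tnth (val d) j)).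
Proof.
move=> b0 e e0.
have bM j : exists M, 1 <= M /\ forall i, vabs (b j i) <= M.
  have /vcvg_nat/(_ 1 ltr01)[N NP] := b0 j.
  (* The 1 bounds the tail and the sum bounds the first [N] terms. Having [1 <= M] lets the leftover
     factor [M j] be dropped at the end. *)
  exists (1 + \sum_(i < N) vabs (b j i));
  split=> [|i]; first by rewrite lerDl sumr_ge0 // => i _; exact: vabs_ge0.
  have [Ni|iN] := leqP N i.
    rewrite -[b j i]subr0 (le_trans (ltW (NP i Ni))) // lerDl.
    by rewrite sumr_ge0 // => k _; exact: vabs_ge0.
  rewrite (bigD1 (Ordinal iN)) //= addrCA lerDl addr_ge0 // sumr_ge0 // => k _.
  exact: vabs_ge0.
have [M MP] := choice bM.
have M0 j : 0 < M j by rewrite (lt_le_trans ltr01) // (MP j).1.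
pose B := \prod_j M j; have B0 : 0 < B by rewrite prodr_gt0.
have bN j : exists N, forall i, (N <= i)%N -> vabs (b j i) < e / B.
  have /vcvg_nat/(_ _ (divr_gt0 e0 B0))[N NP] := b0 j.
  by exists N => i /NP; rewrite subr0.
have [N NP] := choice bN.
pose n := \max_j N j.
(* All decreasing tuples with entries below [n]: [insub] discards the tuples that are not
   decreasing. *)
pose s : seq (decr_tuple r) :=
  pmap insub [seq [tuple of map val t] | t : r.-tuple 'I_n].
exists [fset d in s]%fset => d; rewrite inE mem_pmap_sub => /mapP dn.
have [j jn] : exists j, (n <= tnth (val d) j)%N.
  apply/not_existsP => dlt; apply: dn.
  have lt j : (tnth (val d) j < n)%N by rewrite ltnNge; apply/negP/dlt.
  exists [tuple Ordinal (lt j) | j < r]; first by rewrite mem_enum.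
  by apply: eq_from_tnth => j; rewrite tnth_map tnth_mktuple.
rewrite vabs_prod (bigD1 j) //=.
apply: (@le_lt_trans _ _ (vabs (b j (tnth (val d) j)) * \prod_(i < r | i != j) M i)).
  rewrite ler_wpM2l ?vabs_ge0 // ler_prod // => i _.
  by rewrite vabs_ge0 (MP i).2.
apply: (@lt_le_trans _ _ (e / B * \prod_(i < r | i != j) M i)).
  rewrite ltr_pM2r ?prodr_gt0 // NP // (leq_trans _ jn) //.
  exact: (leq_bigmax j).
rewrite /B (bigD1 j) //= invfM mulrA mulfVK; last by rewrite gt_eqF ?prodr_gt0.
by rewrite ler_pdivrMr // ler_peMr ?(MP j).1 // ltW.
Qed.

End Summation.

(** * Completeness: summability of null families and Cauchy products *)

Section CompleteField.
Variables (R : realType) (K : valuedField R).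
Implicit Types (e rho : R).

Definition vcomplete : Prop :=
  forall u : nat -> K, vcauchy u -> exists l, vcvg u \oo l.

Lemma vcauchy_ultra (u : nat -> K) :
  (forall e, 0 < e -> exists N, forall n, (N <= n)%N -> vabs (u n - u N) < e) ->
  vcauchy u.
Proof.
move=> uN e /uN[N NP]; exists N => m n Nm Nn.
by rewrite -(subrKA (u N)) vabsD_lt ?NP // vabsBC NP.
Qed.

(** Along nested finite sets outside which the terms are at most 1/(n+1), the partial sums form a
    Cauchy sequence; its limit is the unordered sum. *)
Lemma null_family_summable (I : choiceType) (f : I -> K) :
  vcomplete -> null_family f -> vsummable f.
Proof.
move=> Kc f0; have f0n n : exists A : {fset I}, forall i, i \notin A ->
    vabs (f i) < n.+1%:R^-1 by apply: f0; rewrite invr_gt0 ltr0n.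
have [A AP] := choice f0n.
(* Cumulative unions make the chosen sets nested. *)
pose B := nat_rect (fun=> {fset I}) (A 0%N) (fun n X => X `|` A n.+1)%fset.
have AB n : (A n `<=` B n)%fset by case: n => [|n] //=; exact: fsubsetUr.
have BB m n : (m <= n)%N -> (B m `<=` B n)%fset.
  elim: n => [|n IH]; first by rewrite leqn0 => /eqP ->.
  rewrite leq_eqVlt => /predU1P[->//|/IH /fsubset_trans]; apply.
  exact: fsubsetUl.
have fB n i : i \notin B n -> vabs (f i) <= n.+1%:R^-1.
  by move=> iB; apply/ltW/AP; apply: contra iB => /(fsubsetP (AB n)).
have inv_lt e : 0 < e -> exists N, N.+1%:R^-1 < e.
  by move=> e0; exists (Num.trunc e^-1); rewrite invf_plt ?posrE ?ltr0n // truncnS_gt.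
have [l /vcvg_nat ul] : exists l, vcvg (fun n => partial_sum f (B n)) \oo l.
  apply: Kc; apply: vcauchy_ultra => e /inv_lt[N Ne]; exists N => n Nn.
  apply: le_lt_trans Ne; apply: vabs_partial_sumB; rewrite ?invr_ge0 //.
    exact: BB.
  exact: fB.
exists l; apply: vcvg_totally => e e0.
have [N Ne] := inv_lt _ e0; have [M MP] := ul _ e0.
exists (B (maxn N M)); split=> [i iB|]; last by rewrite ltW // MP ?leq_maxr.
apply: (le_trans _ (ltW Ne)); apply: fB; apply: contra iB.
exact/fsubsetP/BB/leq_maxl.
Qed.

Lemma vsum_nat (f : nat -> K) : vcomplete -> vcvg f \oo 0 ->
  vcvg (fun n => \sum_(i < n) f i) \oo (vsum f).
Proof.
move=> Kc f0; have [l fl] : exists l, vcvg (fun n => \sum_(i < n) f i) \oo l.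
  apply: Kc; apply: vcauchy_ultra => e e0; have e20 : 0 < e / 2 by rewrite divr_gt0.
  have /vcvg_nat/(_ _ e20)[N NP] := f0; exists N => n Nn.
  apply: (@le_lt_trans _ _ (e / 2)); last by rewrite gtr_pMr // invf_lt1 ?ltr1n.
  rewrite -!(big_mkord xpredT) (big_cat_nat (leq0n N) Nn) /= addrAC subrr add0r.
  apply: vabs_sum_le => [|i]; first exact: ltW.
  by rewrite mem_index_iota => /andP[/NP + _] _; rewrite subr0 => /ltW.
by rewrite /vsum (vlimE (vcvg_partial_sum_nat f0 fl)).
Qed.

Lemma vcvg_squeeze (u : nat -> K) l (v : nat -> R) :
  (forall n, vabs (u n - l) <= v n) -> v @ \oo --> (0 : R) -> vcvg u \oo l.
Proof.
move=> uv v0; apply: squeeze_cvgr (cvg_cst 0) v0.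
by near=> n; rewrite vabs_ge0 uv.
Unshelve. all: by end_near. Qed.

Definition geom_bounded rho (f : nat -> K) : Prop :=
  exists c, forall m, vabs (f m) <= c * rho ^+ m.

Definition conv (f g : nat -> K) (n : nat) : K :=
  \sum_(i < n.+1) f i * g (n - i)%N.

Section Geometric.
Variable rho : R.
Hypotheses (rho0 : 0 <= rho) (rho1 : rho < 1).

Lemma geom_bounded_cvg0 f : geom_bounded rho f -> vcvg f \oo 0.
Proof.
move=> [c fc]; apply: (@vcvg_squeeze _ _ (fun n => c * rho ^+ n)).
  by move=> n; rewrite subr0.
by apply: cvg_geometric; rewrite ger0_norm.
Qed.

Lemma geom_bounded_conv f g :
  geom_bounded rho f -> geom_bounded rho g -> geom_bounded rho (conv f g).
Proof.
move=> [c fc] [d gd].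
have c0 : 0 <= c by rewrite (le_trans (vabs_ge0 (f 0%N))) // -[c]mulr1.
have d0 : 0 <= d by rewrite (le_trans (vabs_ge0 (g 0%N))) // -[d]mulr1.
exists (c * d) => n; apply: vabs_sum_le => [|i _ _].
  by rewrite !mulr_ge0 ?exprn_ge0.
have -> : rho ^+ n = rho ^+ i * rho ^+ (n - i).
  by rewrite -exprD subnKC // -ltnS.
rewrite vabsM mulrACA.
by rewrite ler_pM ?vabs_ge0.
Qed.

(** The n-th partial sum of the product is the sum of [f i] times the partial sum of [g] of length
    [n - i]. Replacing the latter by [vsum g] costs at most [c d rho^n], since the decay of [f i]
    and of the tail of [g] multiply to [rho^n]. *)
Lemma vsum_conv f g : vcomplete -> geom_bounded rho f -> geom_bounded rho g ->
  vsum (conv f g) = vsum f * vsum g.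
Proof.
move=> Kc bf bg.
have sf := vsum_nat Kc (geom_bounded_cvg0 bf).
have sg := vsum_nat Kc (geom_bounded_cvg0 bg).
have sfg := vsum_nat Kc (geom_bounded_cvg0 (geom_bounded_conv bf bg)).
case: bf bg => [c fc] [d gd].
have c0 : 0 <= c by rewrite (le_trans (vabs_ge0 (f 0%N))) // -[c]mulr1.
have d0 : 0 <= d by rewrite (le_trans (vabs_ge0 (g 0%N))) // -[d]mulr1.
have tail n : vabs (vsum g - \sum_(i < n) g i) <= d * rho ^+ n.
  apply: (vcvg_le sg); exists n => // m /= nm.
  rewrite -!(big_mkord xpredT) (big_cat_nat (leq0n n) nm) /= addrAC subrr add0r.
  apply: vabs_sum_le => [|i]; first by rewrite mulr_ge0 ?exprn_ge0.
  rewrite mem_index_iota => /andP[ni _] _; apply: (le_trans (gd i)).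
  by rewrite ler_wpM2l // ler_wiXn2l // ltW.
have convE n : \sum_(i < n) conv f g i = \sum_(i < n) f i * \sum_(k < n - i) g k.
  elim: n => [|n IH]; first by rewrite !big_ord0.
  rewrite big_ord_recr /= IH [RHS]big_ord_recr /= subSnn big_ord1.
  rewrite /conv big_ord_recr /= subnn addrA -big_split /=; congr (_ + _).
  by apply: eq_bigr => i _; rewrite -mulrDr subSn 1?ltnW // big_ord_recr.
apply: (vcvg_unique sfg).
have dif : vcvg (fun n => \sum_(i < n) f i * (\sum_(k < n - i) g k - vsum g)) \oo 0.
  apply: (@vcvg_squeeze _ _ (fun n => c * d * rho ^+ n)); last first.
    by apply: cvg_geometric; rewrite ger0_norm.
  move=> n; rewrite subr0; apply: vabs_sum_le => [|i _ _].
    by rewrite !mulr_ge0 ?exprn_ge0.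
  have -> : rho ^+ n = rho ^+ i * rho ^+ (n - i).
    by rewrite -exprD subnKC // ltnW.
  rewrite vabsM mulrACA.
  by rewrite ler_pM ?vabs_ge0 // vabsBC.
rewrite [vsum f * _]mulrC -[vsum g * _]add0r.
apply: (eq_vcvg _ (vcvgD dif (vcvgZ (vsum g) sf))) => n.
rewrite convE mulr_sumr -big_split /=.
by apply: eq_bigr => i _; rewrite mulrBr [vsum g * _]mulrC subrK.
Qed.

End Geometric.
End CompleteField.

(** Distributivity with a summation range that depends on the factor, as the range of [m_j] depends
    on [j]. The sums are moved to the common type of tagged pairs, where the non-dependent law
    applies. *)
Lemma prod_sum_dffun (K : comNzRingType) (I : finType) (T : I -> finType)
    (f : forall i, T i -> K) :
  \prod_i \sum_(t : T i) f i t =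
  \sum_(m : {dffun forall i, T i}) \prod_i f i (m i).
Proof.
pose g i := [ffun t : T i => f i t].
transitivity (\prod_i \sum_(t : T i) g i t).
  by apply: eq_bigr => i _; apply: eq_bigr => t _; rewrite ffunE.
under eq_bigr => i _ do rewrite (big_tag (fun i t => g i t)).
rewrite bigA_distr_big_dep; transitivity (\sum_(t : fprod T) \prod_(i in I) g i (t i)).
  by rewrite big_fprod.
rewrite (reindex (@fprod_of_dffun I T)); last exact/onW_bij/fprod_of_dffun_bij.
by apply: eq_bigr => m _; apply: eq_bigr => i _; rewrite fprodE ffunE.
Qed.

(** * The embedding of A and the Frobenius twists *)

Section PowerSums.
Variables (R : realType) (F : finFieldType) (C : Cinfty R F).

Notation q := #|F|.
Notation theta := (embA C 'X).
Notation rho := ((q%:R : R)^-1).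

Let q_gt1 : (1 < q)%N := finNzRing_gt1 F.

Let q_gt0 : (0 < q)%N := ltnW q_gt1.

Let rho_gt0 : 0 < rho.
Proof. by rewrite invr_gt0 ltr0n. Qed.

Let rho_ge0 : 0 <= rho := ltW rho_gt0.

Let rho_lt1 : rho < 1.
Proof. by rewrite invf_lt1 ?ltr1n ?ltr0n. Qed.

Lemma vabs_theta : vabs theta = q%:R.
Proof. by rewrite vabs_embA ?polyX_eq0 // size_polyX expr1. Qed.

Lemma embA_eq0 (a : {poly F}) : (embA C a == 0) = (a == 0).
Proof.
have [->|a0] := eqVneq a 0; first by rewrite rmorph0 eqxx.
by apply/negbTE; rewrite -vabs_gt0 vabs_embA // exprn_gt0 // ltr0n.
Qed.

Lemma theta_neq0 : theta != 0.
Proof. by rewrite embA_eq0 polyX_eq0. Qed.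

Definition frobenius (d : nat) (x : C) : C := x ^+ (q ^ d).

(** [F] is an elementary abelian p-group, so [q] is a power of p, and [C] inherits characteristic p
    through [embA]. This makes the [q^d]-power map additive. *)
Lemma pchar_nat_card d : [pchar C].-nat (q ^ d)%N.
Proof.
have [p _ pF] := finPcharP F; rewrite pnatX; apply/orP; left.
have pC : p \in [pchar C].
  by apply: (rmorph_pchar (embA C)); rewrite pchar_poly.
rewrite (eq_pnat _ (pcharf_eq pC)).
have := abelem_pgroup (fin_ring_pchar_abelem pF).
by rewrite /pgroup cardsT.
Qed.

Lemma frobenius_is_zmod_morphism d : zmod_morphism (frobenius d).
Proof.
move=> x y; rewrite /frobenius exprDn_pchar ?pchar_nat_card //; congr (_ + _).
(* The sign comes from additivity applied to [- y + y = 0], uniformly for even and odd [q]. *)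
apply/eqP; rewrite -subr_eq0 opprK -exprDn_pchar ?pchar_nat_card //.
by rewrite addNr expr0n expn_eq0 -leqn0 leqNgt q_gt0.
Qed.

Lemma frobenius_is_monoid_morphism d : monoid_morphism (frobenius d).
Proof. by split=> [|x y]; rewrite /frobenius ?expr1n ?exprMn. Qed.

HB.instance Definition _ d :=
  GRing.isZmodMorphism.Build C C (frobenius d) (frobenius_is_zmod_morphism d).
HB.instance Definition _ d :=
  GRing.isMonoidMorphism.Build C C (frobenius d) (frobenius_is_monoid_morphism d).

Lemma ps_twist_mul d (f g : nat -> C) :
  ps_twist d (ps_mul f g) = ps_mul (ps_twist d f) (ps_twist d g).
Proof.
apply/funext => n; rewrite /ps_mul -[LHS]/(frobenius d _) rmorph_sum.
by apply: eq_bigr => i _; rewrite rmorphM.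
Qed.

Lemma ps_twist_exp d (f : nat -> C) n :
  ps_twist d (ps_exp f n) = ps_exp (ps_twist d f) n.
Proof.
elim: n => [|n IH]; last by rewrite /ps_exp !iterS ps_twist_mul -!/(ps_exp _ n) IH.
by apply/funext => m; rewrite -[LHS]/(frobenius d _) rmorph_nat.
Qed.

(** * Evaluation of power series at theta *)

(** As |theta| = q, this says that |f_m| q^(2m) is bounded, i.e. [f] has finite Gauss norm at radius
    q^2, which gives geometric convergence at theta. *)
Definition ps_bounded (f : nat -> C) : Prop :=
  geom_bounded rho (fun m => f m * theta ^+ m).

Lemma ps_mul_conv (f g : nat -> C) x :
  (fun m => ps_mul f g m * x ^+ m) =
  conv (fun m => f m * x ^+ m) (fun m => g m * x ^+ m).
Proof.
apply/funext => n; rewrite /conv mulr_suml; apply: eq_bigr => i _.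
by rewrite mulrACA -exprD subnKC // -ltnS.
Qed.

Lemma ps_bounded_mul f g :
  ps_bounded f -> ps_bounded g -> ps_bounded (ps_mul f g).
Proof. by rewrite /ps_bounded ps_mul_conv; exact: geom_bounded_conv. Qed.

Lemma ps_eval_mul f g : ps_bounded f -> ps_bounded g ->
  ps_eval (ps_mul f g) theta = ps_eval f theta * ps_eval g theta.
Proof.
move=> bf bg; rewrite /ps_eval ps_mul_conv.
exact: (vsum_conv rho_ge0 rho_lt1 (@Cinf_complete _ _ C)).
Qed.

Lemma ps_eval_cvg f : ps_bounded f ->
  vcvg (fun n => \sum_(m < n) f m * theta ^+ m) \oo (ps_eval f theta).
Proof.
move=> bf; apply: (vsum_nat (@Cinf_complete _ _ C)).
exact: geom_bounded_cvg0 bf.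
Qed.

Section FiniteSupport.
Variables (f : nat -> C) (n : nat).
Hypothesis f0 : forall m, (n <= m)%N -> f m = 0.

Lemma ps_bounded_finite : ps_bounded f.
Proof.
(* This constant dominates each of the finitely many ratios |f_i theta^i| / rho^i. *)
exists (\sum_(i < n) vabs (f i * theta ^+ i) * rho ^- i) => m.
have s0 (P : pred 'I_n) :
    0 <= \sum_(i < n | P i) vabs (f i * theta ^+ i) * rho ^- i.
  by apply: sumr_ge0 => i _; rewrite mulr_ge0 ?vabs_ge0 ?invr_ge0 ?exprn_ge0.
have [/f0 ->|mn] := leqP n m; first by rewrite mul0r vabs0 mulr_ge0 ?exprn_ge0.
rewrite -ler_pdivrMr ?exprn_gt0 // (bigD1 (Ordinal mn)) //=.
by rewrite lerDl s0.
Qed.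

Lemma ps_eval_finite : ps_eval f theta = \sum_(i < n) f i * theta ^+ i.
Proof.
apply: vcvg_unique (ps_eval_cvg ps_bounded_finite) _.
apply/vcvg_nat => e e0; exists n => m nm.
rewrite -!(big_mkord xpredT (fun i => f i * theta ^+ i)).
rewrite (big_cat_nat (leq0n n) nm) /= addrAC subrr add0r big_nat big1 ?vabs0 //.
by move=> i /andP[/f0 -> _]; rewrite mul0r.
Qed.

End FiniteSupport.

Lemma ps_exp_bounded_eval f n : ps_bounded f -> ps_bounded (ps_exp f n) /\
  ps_eval (ps_exp f n) theta = ps_eval f theta ^+ n.
Proof.
move=> bf; elim: n => [|n [bn en]].
  have f0 m : (1 <= m)%N -> ps_exp f 0 m = 0 by case: m.
  split; first exact: ps_bounded_finite f0.
  by rewrite (ps_eval_finite f0) big_ord1 mulr1.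
rewrite /ps_exp iterS -/(ps_exp f n); split; first exact: ps_bounded_mul.
by rewrite ps_eval_mul // en exprS.
Qed.

(** * Values at theta of the twists of Omega *)

Section OmegaValue.
Variable theta' : C.
Hypothesis theta'E : theta' ^+ (q - 1) = - theta.

Let theta'_neq0 : theta' != 0.
Proof.
apply/eqP => t0; move: theta'E; rewrite t0 expr0n subn_eq0 leqNgt q_gt1 /=.
by move/esym/eqP; rewrite oppr_eq0 (negbTE theta_neq0).
Qed.

Definition Omega_part (N : nat) : {poly C} :=
  (theta' ^- q)%:P * \prod_(1 <= i < N.+1) (1 - (theta ^- (q ^ i)) *: 'X).

Let c : R := vabs (theta' ^- q).

Let c_ge0 : 0 <= c := vabs_ge0 _.

Lemma Omega_part0 : Omega_part 0 = (theta' ^- q)%:P.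
Proof. by rewrite /Omega_part big_nil mulr1. Qed.

Lemma coef_Omega_partS N m : (Omega_part N.+1)`_m =
  (Omega_part N)`_m - theta ^- (q ^ N.+1) * (Omega_part N * 'X)`_m.
Proof.
rewrite {1}/Omega_part big_nat_recr //= mulrA -/(Omega_part N).
by rewrite mulrBr mulr1 -scalerAr coefB coefZ.
Qed.

Lemma vabs_theta_expV n : vabs (theta ^- n) = rho ^+ n.
Proof. by rewrite vabsV vabsX vabs_theta exprVn. Qed.

(** The new factor adds coefficient [m - 1] divided by theta^(q^(N+1)), up to sign. The bound on
    [Omega_part N] is a hypothesis because the induction that establishes it uses this step. *)
Lemma vabs_Omega_part_step N m :
  (forall i, vabs (Omega_part N)`_i <= c * rho ^+ (2 * i)) ->
  vabs ((Omega_part N.+1)`_m - (Omega_part N)`_m) <= c * rho ^+ (2 * m + N).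
Proof.
move=> bN; rewrite coef_Omega_partS addrAC subrr add0r vabsN vabsM coefMX.
case: m => [|i] /=; first by rewrite vabs0 mulr0 mulr_ge0 ?exprn_ge0.
rewrite vabs_theta_expV; apply: le_trans (ler_wpM2l _ (bN i)) _.
  exact: exprn_ge0.
rewrite mulrCA -exprD ler_wpM2l // ler_wiXn2l ?ltW //.
(* The index shift loses 2 and the claim gains [N]; both are paid for by N + 2 <= q^(N+1). *)
by rewrite mulnS addnAC leq_add2r add2n ltn_expl.
Qed.

(* The Gauss norm of [Omega_part N] at radius q^2 is at most [c]: each factor
   1 - t / theta^(q^i) has Gauss norm 1 there because 2 <= q^i. *)
Lemma vabs_Omega_part N m : vabs (Omega_part N)`_m <= c * rho ^+ (2 * m).
Proof.
elim: N m => [|N IH] m.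
  rewrite Omega_part0 coefC; case: m => [|m]; first by rewrite mulr1.
  by rewrite vabs0 mulr_ge0 ?exprn_ge0.
rewrite -[(Omega_part N.+1)`_m](subrK (Omega_part N)`_m) vabsD_le //.
apply: le_trans (vabs_Omega_part_step m IH) _.
by rewrite ler_wpM2l // ler_wiXn2l ?ltW // leq_addr.
Qed.

Lemma vabs_Omega_partB N n m : (N <= n)%N ->
  vabs ((Omega_part n)`_m - (Omega_part N)`_m) <= c * rho ^+ (2 * m + N).
Proof.
elim: n => [|n IH].
  by rewrite leqn0 => /eqP ->; rewrite subrr vabs0 mulr_ge0 ?exprn_ge0.
rewrite leq_eqVlt => /predU1P[->|Nn]; first by rewrite subrr vabs0 mulr_ge0 ?exprn_ge0.
rewrite -(subrKA (Omega_part n)`_m) vabsD_le ?IH //.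
apply: le_trans (vabs_Omega_part_step m (vabs_Omega_part n)) _.
by rewrite ler_wpM2l // ler_wiXn2l ?ltW // leq_add2l.
Qed.

Lemma Omega_cvg m : vcvg (fun N => (Omega_part N)`_m) \oo (Omega theta' m).
Proof.
suff [l ul] : exists l, vcvg (fun N => (Omega_part N)`_m) \oo l.
  by have -> : Omega theta' m = l by apply: vlimE ul.
apply: Cinf_complete; apply: vcauchy_ultra => e e0.
have small : vcvg (fun N => theta ^- N) \oo 0.
  apply: (vcvg_squeeze (v := fun N => 1 * rho ^+ N)) => [N|].
    by rewrite subr0 vabs_theta_expV mul1r.
  by apply: cvg_geometric; rewrite ger0_norm.
have c1 : 0 < c + 1 by rewrite ltr_wpDl.
have /vcvg_nat/(_ (e / (c + 1)) (divr_gt0 e0 c1))[N NP] := small.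
exists N => n Nn; apply: le_lt_trans (vabs_Omega_partB m Nn) _.
have := NP N (leqnn N); rewrite subr0 vabs_theta_expV ltr_pdivlMr // => /le_lt_trans.
apply.
rewrite mulrC ler_pM ?exprn_ge0 //.
  by rewrite ler_wiXn2l ?ltW // leq_addl.
by rewrite lerDl.
Qed.

Lemma vabs_OmegaB N m :
  vabs (Omega theta' m - (Omega_part N)`_m) <= c * rho ^+ (2 * m + N).
Proof.
apply: (vcvg_le (Omega_cvg m)); exists N => // n /= Nn.
exact: vabs_Omega_partB.
Qed.

Lemma vabs_Omega m : vabs (Omega theta' m) <= c * rho ^+ (2 * m).
Proof.
rewrite -(subr0 (Omega theta' m)); apply: (vcvg_le (Omega_cvg m)).
by exists 0%N => // n _ /=; rewrite subr0 vabs_Omega_part.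
Qed.

(** Raising to the power [q^d] only shrinks the power of [rho], and |theta|^m cancels [m] of the
    exponent 2m + N. *)
Lemma vabs_twist_term d x m N : vabs x <= c * rho ^+ (2 * m + N) ->
  vabs (x ^+ (q ^ d) * theta ^+ m) <= c ^+ (q ^ d) * rho ^+ (m + N).
Proof.
move=> xb; rewrite vabsM !vabsX vabs_theta.
have qd : (0 < q ^ d)%N by rewrite expn_gt0 q_gt0.
have -> : rho ^+ (m + N) = rho ^+ (2 * m + N) * q%:R ^+ m.
  rewrite mul2n -addnn addnAC [in RHS]exprD -mulrA -exprMn mulVf ?expr1n ?mulr1 //.
  by rewrite pnatr_eq0 -lt0n.
rewrite mulrA ler_wpM2r ?exprn_ge0 //.
apply: (@le_trans _ _ ((c * rho ^+ (2 * m + N)) ^+ (q ^ d))).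
  by rewrite lerXn2r ?nnegrE ?vabs_ge0 ?mulr_ge0 ?exprn_ge0.
rewrite exprMn ler_wpM2l ?exprn_ge0 // -exprM ler_wiXn2l ?ltW //.
exact: leq_pmulr.
Qed.

Lemma ps_bounded_twist_Omega d : ps_bounded (ps_twist d (Omega theta')).
Proof.
exists (c ^+ (q ^ d)) => m; rewrite -[m in rho ^+ m]addn0.
by apply: vabs_twist_term; rewrite addn0 vabs_Omega.
Qed.

Definition Omega_part_value d N : C := (map_poly (frobenius d) (Omega_part N)).[theta].

(** The bound [c rho^(2m + N)] on the coefficient errors is uniform enough in [m] for evaluation at
    theta to commute with the limit of the partial products. *)
Lemma Omega_part_value_cvg d :
  vcvg (Omega_part_value d) \oo (ps_eval (ps_twist d (Omega theta')) theta).
Proof.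
apply: (vcvg_squeeze (v := fun N => c ^+ (q ^ d) * rho ^+ N)); last first.
  by apply: cvg_geometric; rewrite ger0_norm.
move=> N; rewrite vabsBC.
apply: (vcvg_le (ps_eval_cvg (ps_bounded_twist_Omega d))).
exists (size (Omega_part N)) => // n /= Nn.
rewrite /Omega_part_value (@horner_coef_wide _ n) ?size_map_poly //.
rewrite -sumrB; apply: vabs_sum_le => [|m _ _].
  by rewrite mulr_ge0 ?exprn_ge0.
rewrite coef_map -mulrBl -[ps_twist d _ m]/(frobenius d (Omega theta' m)) -rmorphB.
apply: le_trans (vabs_twist_term d (vabs_OmegaB N m)) _.
by rewrite ler_wpM2l ?exprn_ge0 // ler_wiXn2l ?ltW // leq_addl.
Qed.

Lemma Omega_part_valueE d N : Omega_part_value d N =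
  theta' ^- (q ^ d.+1) * \prod_(1 <= i < N.+1) (1 - theta / theta ^+ (q ^ (i + d))).
Proof.
have frobV (x : C) n : frobenius d (x ^- n) = x ^- (n * q ^ d).
  by rewrite /frobenius exprVn -exprM.
rewrite /Omega_part_value rmorphM /= hornerM map_polyC hornerC /= frobV -expnS.
congr (_ * _); rewrite rmorph_prod horner_prod; apply: eq_bigr => i _.
by rewrite rmorphB rmorph1 /= map_polyZ map_polyX !hornerE /= frobV -expnD mulrC.
Qed.

(** Split off the factor i = 1, namely 1 - theta / theta^(q^(d+1)). The others are the factors of
    the twist by d + 1, and the leading constants are compared through theta'^(q-1) = -theta. *)
Lemma Omega_part_value_rec d N : Omega_part_value d N.+1 =
  (theta - theta ^+ (q ^ d.+1)) * Omega_part_value d.+1 N.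
Proof.
rewrite !Omega_part_valueE big_nat_recl // mulrA [RHS]mulrA.
congr (_ * _); last by apply: eq_bigr => i _; rewrite addSnnS.
set k := (q ^ d.+1)%N; have -> : theta' ^+ (q ^ d.+2) = - (theta' ^+ k * theta ^+ k).
  (* With k = q^(d+1), the exponent qk is split as k + (q-1)k to expose theta'^(q-1). *)
  have -> : (q ^ d.+2)%N = (k + (q - 1) * k)%N.
    by rewrite expnS -mulSn subn1 prednK.
  rewrite exprD exprM theta'E -[(- theta) ^+ k]/(frobenius d.+1 _) rmorphN.
  by rewrite mulrN.
have n1 : theta ^+ k != 0 by rewrite expf_neq0 ?theta_neq0.
have n2 : theta' ^+ k != 0 by rewrite expf_neq0.
by rewrite -/k; field; rewrite oppr_eq0 mulf_neq0 ?n1.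
Qed.

Lemma ps_eval_Omega_rec d :
  ps_eval (ps_twist d (Omega theta')) theta =
  (theta - theta ^+ (q ^ d.+1)) * ps_eval (ps_twist d.+1 (Omega theta')) theta.
Proof.
apply: vcvg_unique (vcvg_shift (Omega_part_value_cvg d)) _.
apply: eq_vcvg (vcvgZ _ (Omega_part_value_cvg d.+1)) => N.
by rewrite Omega_part_value_rec.
Qed.

Lemma ps_twist0 (f : nat -> C) : ps_twist 0 f = f.
Proof. by apply/funext => m; rewrite /ps_twist expn0 expr1. Qed.

Lemma ps_eval_Omega d : ps_eval (Omega theta') theta =
  embA C (carlitz_L F d) * ps_eval (ps_twist d (Omega theta')) theta.
Proof.
elim: d => [|d IH].
  by rewrite ps_twist0 /carlitz_L big_nil rmorph1 mul1r.
rewrite IH ps_eval_Omega_rec mulrA; congr (_ * _).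
by rewrite /carlitz_L [in RHS]big_nat_recr //= rmorphM rmorphB !rmorphXn.
Qed.

(** Each factor 1 - theta / theta^(q^i) has absolute value 1, so every partial value has absolute
    value exactly [c > 0] and the limit cannot vanish. *)
Lemma ps_eval_Omega_neq0 : ps_eval (Omega theta') theta != 0.
Proof.
apply/eqP => W0; have c_gt0 : 0 < c by rewrite vabs_gt0 invr_neq0 ?expf_neq0.
have := Omega_part_value_cvg 0; rewrite ps_twist0 W0.
move=> /vcvg_nat/(_ c c_gt0)[N /(_ N (leqnn N))].
rewrite subr0 Omega_part_valueE expn1 vabsM -/c vabs_prod big_nat big1 ?mulr1 ?ltxx //.
move=> i /andP[i0 _]; rewrite addn0.
have lt1 : vabs (theta / theta ^+ (q ^ i)) < 1.
  rewrite vabsM vabs_theta_expV vabs_theta; apply: le_lt_trans rho_lt1.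
  have rhoE : rho = q%:R * rho ^+ 2 by rewrite expr2 mulVKf ?pnatr_eq0 -?lt0n.
  by rewrite [leRHS]rhoE ler_wpM2l // ler_wiXn2l ?ltW // (leq_trans _ (ltn_expl i _)).
apply/eqP; rewrite eq_le; apply/andP; split.
  by apply: vabsD_le; rewrite ?vabs1 // vabsN ltW.
(* Otherwise 1 would be a sum of two elements of absolute value below 1. *)
rewrite leNgt; apply/negP => lt2; have : vabs (1 : C) < 1.
  by rewrite -(subrK (theta / theta ^+ (q ^ i)) 1) vabsD_lt.
by rewrite vabs1 ltxx.
Qed.

End OmegaValue.

(** * Power sums through polylogarithm factors, and the decay of these factors *)

Lemma carlitz_Gamma_neq0 s : carlitz_Gamma F s != 0.
Proof.
apply/prodf_neq0 => i _; rewrite expf_neq0 //; apply/prodf_neq0 => k _.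
rewrite subr_eq0; apply/eqP => /(congr1 (fun p : {poly F} => size p)).
rewrite !size_polyXn => -[/eqP]; rewrite eqn_exp2l // => /eqP ik.
by have := ltn_ord k; rewrite -ik ltnn.
Qed.

Lemma carlitz_L_neq0 d : carlitz_L F d != 0.
Proof.
rewrite /carlitz_L prodf_seq_neq0; apply/allP => j /=.
rewrite mem_index_iota => /andP[j0 _].
rewrite subr_eq0; apply/eqP => /(congr1 (fun p : {poly F} => size p)).
rewrite size_polyX size_polyXn => -[qj]; have := ltn_expl j q_gt1.
by rewrite -qj ltnS leqNgt j0.
Qed.

(** The range [.-1.+1] is the size of the polynomial, except for the zero polynomial, where the
    single term m = 0 vanishes. *)
Lemma power_sumE (theta' : C) (H : nat -> {poly {poly F}}) d s :
  theta' ^+ (q - 1) = - theta -> anderson_thakur theta' H -> (0 < s)%N ->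
  power_sum C d s = (embA C (carlitz_Gamma F s))^-1 *
    \sum_(m < (size (H s.-1)).-1.+1) theta ^+ m *
      (embA C (H s.-1)`_m ^+ (q ^ d) / embA C (carlitz_L F d) ^+ s).
Proof.
move=> theta'E [HE _] s0; have := HE d s s0.
have h0 m : ((size (H s.-1)).-1.+1 <= m)%N ->
    ps_twist d (ps_of_At C (H s.-1)) m = 0.
  move=> hm; rewrite -[LHS]/(frobenius d _) /ps_of_At nth_default ?rmorph0 //.
  by rewrite (leq_trans _ hm) // leqSpred.
have [bO eO] := ps_exp_bounded_eval s (ps_bounded_twist_Omega theta' d).
rewrite ps_twist_mul ps_twist_exp ps_eval_mul //; last exact: ps_bounded_finite h0.
rewrite (ps_eval_finite h0) eO /pi_tilde exprVn invrK.
have W0 := ps_eval_Omega_neq0 theta'E; have L0 : embA C (carlitz_L F d) != 0.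
  by rewrite embA_eq0 carlitz_L_neq0.
(* Substituting W_0 = L_d W_d puts W_d^s on both sides, where it cancels. *)
rewrite (ps_eval_Omega theta'E d) in W0 *.
move: W0; rewrite mulf_eq0 negb_or => /andP[_ W0].
rewrite exprMn mulrA => /(mulIf (expf_neq0 s W0)) E.
have G0 : embA C (carlitz_Gamma F s) != 0 by rewrite embA_eq0 carlitz_Gamma_neq0.
apply: (mulfI G0); rewrite mulVKf //; apply: (mulIf (expf_neq0 s L0)).
rewrite -E mulr_suml; apply: eq_bigr => m _.
by rewrite mulrA mulfVK ?expf_neq0 // mulrC.
Qed.

(** The degree of L_i is q + ... + q^i = (q^(i+1) - q)/(q-1); the denominator is cleared to keep
    natural exponents. *)
Lemma vabs_carlitz_L i :
  vabs (embA C (carlitz_L F i)) ^+ (q - 1) * q%:R ^+ q = q%:R ^+ (q ^ i.+1).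
Proof.
elim: i => [|i IH].
  by rewrite /carlitz_L big_nil rmorph1 vabs1 expr1n mul1r expn1.
rewrite /carlitz_L big_nat_recr //= rmorphM vabsM exprMn mulrAC IH.
have sz : size ('X - 'X^(q ^ i.+1) : {poly F}) = (q ^ i.+1).+1.
  rewrite -size_polyN opprB size_polyDl ?size_polyXn // size_polyN size_polyX.
  by rewrite ltnS -[X in (X < _)%N](expn0 q) ltn_exp2l.
rewrite vabs_embA -?size_poly_eq0 sz //= -exprM -exprD -mulnS.
by rewrite subn1 prednK // -expnSr.
Qed.

(** After raising to the power q - 1, the numerator contributes at most s - 1 copies of q^(q^(i+1))
    against s copies in the denominator, up to a constant; one copy survives and forces decay. *)
Lemma Li_factor_cvg0 (u : {poly F}) s : (0 < s)%N ->
  ((size u).-1 * (q - 1) <= s.-1 * q)%N ->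
  vcvg (fun i => embA C u ^+ (q ^ i) / embA C (carlitz_L F i) ^+ s) \oo 0.
Proof.
(* From here on [s] is the original exponent minus one. *)
case: s => // s _ /= us; have q1 : (0 < q - 1)%N by rewrite subn_gt0.
have Q0 : 0 < q%:R :> R by rewrite ltr0n.
have Q_ge0 := ltW Q0.
set b := fun i => embA C u ^+ (q ^ i) / _.
have uq : vabs (embA C u) ^+ (q - 1) <= q%:R ^+ (s * q).
  have [->|u0] := eqVneq u 0.
    by rewrite rmorph0 vabs0 expr0n gtn_eqF // exprn_ge0.
  by rewrite vabs_embA // -exprM ler_weXn2l // ler1n.
have bq i : vabs (b i) ^+ (q - 1) <= q%:R ^+ (q * s.+1) * rho ^+ i.
  set n := (q ^ i.+1)%N.
  (* The true decay [rho^(q^(i+1))] is weakened to [rho^i] to compare with a geometric sequence. *)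
  apply: (@le_trans _ _ (q%:R ^+ (q * s.+1) * rho ^+ n)); last first.
    rewrite ler_wpM2l ?exprn_ge0 // ler_wiXn2l ?(ltW rho_lt1) //.
    exact: leq_trans (leqnSn i) (ltnW (ltn_expl i.+1 q_gt1)).
  have LE : vabs (embA C (carlitz_L F i)) ^+ (q - 1) = q%:R ^+ n / q%:R ^+ q.
    by rewrite -vabs_carlitz_L mulfK // expf_neq0 // gt_eqF.
  have -> : vabs (b i) ^+ (q - 1) = (vabs (embA C u) ^+ (q - 1)) ^+ (q ^ i) /
      (vabs (embA C (carlitz_L F i)) ^+ (q - 1)) ^+ s.+1.
    by rewrite vabsM vabsV !vabsX exprMn exprVn; congr (_ / _); exact: exprAC.
  rewrite LE; apply: (@le_trans _ _ ((q%:R ^+ (s * q)) ^+ (q ^ i) /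
      (q%:R ^+ n / q%:R ^+ q) ^+ s.+1)).
    rewrite ler_wpM2r ?invr_ge0 ?exprn_ge0 ?divr_ge0 ?exprn_ge0 //.
    by rewrite lerXn2r ?nnegrE ?exprn_ge0 ?vabs_ge0.
  rewrite -!exprM -mulnA -expnS -/n expr_div_n invf_div -!exprM mulrCA.
  rewrite [(n * s.+1)%N]mulnS.
  rewrite ler_wpM2l ?exprn_ge0 //.
  rewrite [q%:R ^+ (n + _)]exprD invfM mulrCA [(s * n)%N]mulnC divff ?mulr1 ?exprVn //.
  by rewrite expf_neq0 // gt_eqF.
have bq0 : vcvg (fun i => b i ^+ (q - 1)) \oo 0.
  apply: (vcvg_squeeze (v := fun i => q%:R ^+ (q * s.+1) * rho ^+ i)) => [i|].
    by rewrite subr0 vabsX.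
  by apply: cvg_geometric; rewrite ger0_norm.
(* The threshold [e^(q-1)] transfers convergence from the (q-1)-th powers back to [b]. *)
apply/vcvg_nat => e e0; have /vcvg_nat/(_ _ (exprn_gt0 (q - 1) e0))[N NP] := bq0.
exists N => i /NP; rewrite !subr0 vabsX ltr_pXn2r ?nnegrE ?vabs_ge0 //.
exact: ltW.
Qed.

End PowerSums.

(** * Summation over decreasing tuples *)

Theorem theorem5p5p2 (R : realType) (F : finFieldType) (C : Cinfty R F)
    (theta' : C) (htheta' : theta' ^+ (#|F| - 1) = - embA C 'X)
    (H : nat -> {poly {poly F}}) (hH : anderson_thakur theta' H)
    (r : nat) (s : 'I_r -> nat) (hs : forall j, (0 < s j)%N) :
  (forall m : 'I_r -> nat,
     (forall j, (m j <= (size (H (s j).-1)).-1)%N) ->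
     Li_domain s (fun j => embA C (H (s j).-1)`_(m j))) /\
  multizeta C s =
    (\prod_(j < r) embA C (carlitz_Gamma F (s j)))^-1 *
    \sum_(m : {dffun forall j : 'I_r, 'I_(size (H (s j).-1)).-1.+1})
       embA C 'X ^+ (\sum_(j < r) m j)%N *
       Li s (fun j => embA C (H (s j).-1)`_(m j)).
Proof.
have dom (m : 'I_r -> nat) : Li_domain s (fun j => embA C (H (s j).-1)`_(m j)).
  apply: null_family_summable; first exact: Cinf_complete.
  pose b j i := embA C (H (s j).-1)`_(m j) ^+ (#|F| ^ i) / embA C (carlitz_L F i) ^+ s j.
  apply: (@vcvg_null_prod _ _ _ b) => j; apply: Li_factor_cvg0 => //.
  (* The bound on the degree in theta of the whole polynomial passes to each of its coefficients. *)
  apply: leq_trans (hH.2 (s j).-1).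
  rewrite leq_mul2r -!subn1 leq_sub2r ?orbT //; exact: max_size_coefXY.
(* Summability makes [Li] a genuine limit and not the default value of [vlim]. *)
have LiE (m : 'I_r -> nat) :
    vcvg (partial_sum (Li_term s (fun j => embA C (H (s j).-1)`_(m j)))) totally
      (Li s (fun j => embA C (H (s j).-1)`_(m j))).
  by have [l lP] := dom m; rewrite /Li /vsum (vlimE lP).
split=> [m _|]; first exact: dom.
(* The right-hand side is a finite combination of limits, so it suffices to match partial sums over
   each finite set [A] of tuples. *)
apply: vlimE; apply: (eq_vcvg _ (vcvgZ _ (vcvg_sum (index_enum _)
  (fun m : {dffun forall j, 'I_(size (H (s j).-1)).-1.+1} =>
    vcvgZ (embA C 'X ^+ (\sum_(j < r) m j)%N) (LiE (fun j => m j)))))) => A.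
rewrite partial_sumE mulr_sumr.
under eq_bigr => m _ do rewrite partial_sumE mulr_sumr mulr_sumr.
rewrite exchange_big; apply: eq_bigr => d _ /=.
under [RHS]eq_bigr => j _ do rewrite (power_sumE _ htheta' hH (hs j)).
(* For a fixed tuple [d], expanding the product over [j] of the sums over [m_j] yields the sum over
   all [m]. *)
rewrite big_split /= prodfV prod_sum_dffun mulr_sumr; apply: eq_bigr => m _.
by rewrite big_split /= -expr_sum.
Qed.
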